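(* Let $G$ be a $(d,k)$-graph with $n$ vertices, and let $A$ be its adjacency matrix. Then every nontrivial eigenvalue $\lambda<d$ of $A$ satisfies $$\left|\sum_{t=0}^{k} P_t(\lambda)\right|\le \mu_{d,k}-n .$$
   Context: A $(d,k)$-graph is a finite simple undirected $d$-regular graph of diameter $k$ (the maximum distance between two vertices is $k$), where $d,k\ge 1$. The Moore Bound is $\mu_{d,k}:=1+d\sum_{i=0}^{k-1}(d-1)^i$ (with $0^0=1$). The Geronimus Polynomials (for the fixed degree $d$) are defined by $P_0(x)=1$, $P_1(x)=x$, $P_2(x)=x^2-d$, and $P_t(x)=xP_{t-1}(x)-(d-1)P_{t-2}(x)$ for $t>2$. The eigenvalues of $A$ are real, the largest is $d$ (with eigenvector the all-ones vector); the nontrivial eigenvalues are the ones different from $d$. *)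

(* Defs.v *)
From mathcomp Require Import all_boot all_order all_algebra.

Set Implicit Arguments.
Unset Strict Implicit.
Unset Printing Implicit Defensive.

Import GRing.Theory Num.Theory.
Local Open Scope ring_scope.

Definition has_walk (T : finType) (e : rel T) (m : nat) (x y : T) : bool :=
  [exists p : m.-tuple T, path e x p && (last x p == y)].

(* The distance is a relation rather than a function: it holds for no m when x
   and y lie in different connected components. *)
Definition is_dist (T : finType) (e : rel T) (x y : T) (m : nat) : Prop :=
  has_walk e m x y /\ (forall l : nat, has_walk e l x y -> (m <= l)%N).

Definition is_diameter (T : finType) (e : rel T) (k : nat) : Prop :=
  (forall x y : T, exists2 m : nat, is_dist e x y m & (m <= k)%N) /\
  (exists x y : T, is_dist e x y k).

Record dk_graph (T : finType) (e : rel T) (d k : nat) : Prop := DKGraph {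
  dk_degree_gt0 : (0 < d)%N;
  dk_diameter_gt0 : (0 < k)%N;
  dk_sym : symmetric e;
  dk_irrefl : irreflexive e;
  dk_regular : forall x : T, #|[set y | e x y]| = d;
  dk_diameter : is_diameter e k
}.

Definition adjacency (R : nzRingType) (T : finType) (e : rel T) : 'M[R]_#|T| :=
  \matrix_(i, j) (e (enum_val i) (enum_val j))%:R.

Definition nontrivial_eigenvalue (R : fieldType) (T : finType) (e : rel T)
    (d : nat) (lambda : R) : bool :=
  eigenvalue (adjacency R e) lambda && (lambda != d%:R).

Definition moore_bound (d k : nat) : nat :=
  (1 + d * \sum_(i < k) (d - 1) ^ i)%N.

Fixpoint geronimus (R : nzRingType) (d t : nat) {struct t} : {poly R} :=
  match t with
  | 0 => 1
  | 1 => 'X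
  | 2 => 'X^2 - d%:R%:P
  | ((_.+1 as t2).+1 as t1).+1 =>
      'X * geronimus R d t1 - (d%:R - 1) *: geronimus R d t2
  end.

(* Main.v *)
Require Import Defs.
From mathcomp Require Import all_boot all_order all_algebra.
From mathcomp Require Import ring.

Set Implicit Arguments.
Unset Strict Implicit.
Unset Printing Implicit Defensive.

Import GRing.Theory Num.Theory.
Local Open Scope ring_scope.

(** The matrix [P_t(A)] counts non-backtracking walks of length [t], so it has
    nonnegative entries, and [S = P_0(A) + ... + P_k(A)] has all entries at
    least [1] because a shortest path does not backtrack.  Hence [S - J] is
    nonnegative with constant row sum [mu - n].  An eigenvector of [A] for
    [lambda != d] is killed by [J], so it is an eigenvector of [S - J] for the
    sum of the [P_t(lambda)]; comparing at a coordinate of maximal modulus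
    bounds this eigenvalue by the row sum. *)

Lemma horner_geronimusSSS (R : comNzRingType) (d t : nat) (x : R) :
  (geronimus R d t.+3).[x] =
  x * (geronimus R d t.+2).[x] - (d%:R - 1) * (geronimus R d t.+1).[x].
Proof.
rewrite -[geronimus R d t.+3]/('X * geronimus R d t.+2
                               - (d%:R - 1) *: geronimus R d t.+1).
by rewrite hornerD hornerN hornerM hornerX hornerZ.
Qed.

Section NonBacktrackingWalks.

Variables (R : realDomainType) (T : finType) (e : rel T).

(* Number of non-backtracking walks of length [t.+1] from [x] to [y] whose
   first step goes to [z]. *)
Fixpoint nbwalks_via (t : nat) (x z y : T) : R :=
  (e x z)%:R *
  (if t is t'.+1 then \sum_(w | w != x) nbwalks_via t' z w y else (z == y)%:R).

Definition nbwalks (t : nat) (x y : T) : R :=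
  if t is t'.+1 then \sum_z nbwalks_via t' x z y else (x == y)%:R.

Lemma nbwalks_via_ge0 t x z y : 0 <= nbwalks_via t x z y.
Proof.
elim: t x z => [|t IHt] x z /=; rewrite mulr_ge0 ?ler0n //.
by apply: sumr_ge0 => w _; apply: IHt.
Qed.

Lemma nbwalks_ge0 t x y : 0 <= nbwalks t x y.
Proof.
case: t => [|t] /=; first exact: ler0n.
by apply: sumr_ge0 => z _; apply: nbwalks_via_ge0.
Qed.

Lemma adj_mulK x z (c : R) : (e x z)%:R * ((e x z)%:R * c) = (e x z)%:R * c.
Proof. by rewrite mulrA -natrM mulnb andbb. Qed.

Lemma nbwalks_via_mul_adj t x z y :
  (e x z)%:R * nbwalks_via t x z y = nbwalks_via t x z y.
Proof. by case: t => [|t]; apply: adj_mulK. Qed.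

(** A geodesic never backtracks, so at each step its next vertex indexes a term of the restricted
    sum; the other terms are nonnegative. *)
Lemma nbwalks_via_geodesic x z p :
  path e x (z :: p) ->
  (forall q, path e x q -> last x q = last z p -> (size p < size q)%N) ->
  1 <= nbwalks_via (size p) x z (last z p).
Proof.
elim: p x z => [|w p IHp] x z /=; first by rewrite andbT eqxx => -> _; rewrite mulr1.
case/and3P=> xz zw wp geo; rewrite xz mul1r.
(* If [w = x], then [p] alone leads from [x] to the same end, two steps shorter. *)
have wx : w != x.
  by apply/eqP=> wx; move: wp (geo p); rewrite wx => wp /(_ wp erefl); rewrite ltnNge leqnSn.
rewrite (bigD1 w) //= -[1]addr0 lerD //; last first.
  by apply: sumr_ge0 => ? _; apply: nbwalks_via_ge0.
apply: IHp => [|q zq lq]; first by rewrite /= zw.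
by have := geo (z :: q); rewrite /= xz zq lq; apply.
Qed.

Lemma nbwalks_is_dist x y m : is_dist e x y m -> 1 <= nbwalks m x y.
Proof.
case=> /existsP[[p /= /eqP <-] /andP[xp /eqP <-]] geo.
case: p xp geo => [|z p] xp geo; first by rewrite /= eqxx.
rewrite /= (bigD1 z) //= -[1]addr0 lerD //; last first.
  by apply: sumr_ge0 => ? _; apply: nbwalks_via_ge0.
apply: nbwalks_via_geodesic => // q xq lq; apply: geo.
by apply/existsP; exists (in_tuple q); rewrite /= xq lq /= eqxx.
Qed.

Variable d : nat.
Hypotheses (sym_e : symmetric e) (reg_e : forall x, #|[set y | e x y]| = d).

Lemma sum_adj x : \sum_y (e x y)%:R = d%:R :> R.
Proof.
rewrite -natr_sum -(reg_e x) -sum1dep_card [in RHS]big_mkcond /=.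
by congr (_%:R); apply: eq_bigr => y _; case: (e x y).
Qed.

(** The restriction [w != x] is lifted by subtracting the walks from [z] that return at once to
    [x]. *)
Lemma nbwalksS t x y :
  nbwalks t.+2 x y =
  \sum_z (e x z)%:R * (nbwalks t.+1 z y - nbwalks_via t z x y).
Proof.
apply: eq_bigr => z _ /=; congr (_ * _).
by rewrite [in RHS](bigD1 x) //= addrC addrK.
Qed.

Lemma nbwalks1 x y : nbwalks 1 x y = \sum_z (e x z)%:R * nbwalks 0 z y.
Proof. by []. Qed.

(** The walk ends after returning to [x], so all [d] detours [x, z, x] are subtracted. *)
Lemma nbwalks2 x y :
  nbwalks 2 x y =
  \sum_z (e x z)%:R * nbwalks 1 z y - d%:R * nbwalks 0 x y.
Proof.
rewrite nbwalksS -(sum_adj x) mulr_suml -sumrB; apply: eq_bigr => z _.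
by rewrite mulrBr /= [e z x]sym_e adj_mulK.
Qed.

(** Here the walk goes on from [x] to some [w != z] after the detour [x, z, x]: each [w] leaves only
    [d - 1] choices of [z]. *)
Lemma nbwalks3 t x y :
  nbwalks t.+3 x y =
  \sum_z (e x z)%:R * nbwalks t.+2 z y - (d%:R - 1) * nbwalks t.+1 x y.
Proof.
rewrite nbwalksS; under eq_bigr do rewrite mulrBr.
rewrite sumrB; congr (_ - _).
transitivity (\sum_z \sum_(w | w != z) (e x z)%:R * nbwalks_via t x w y).
  apply: eq_bigr => z _.
  by rewrite /= [e z x]sym_e adj_mulK mulr_sumr.
rewrite (exchange_big_dep xpredT) //= mulr_sumr; apply: eq_bigr => w _.
rewrite -mulr_suml -(sum_adj x) [in RHS](bigD1 w) //=.
under eq_bigl do rewrite eq_sym.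
(* The count [d - 1] is right only when [w] is a neighbour of [x]; otherwise both sides vanish. *)
rewrite -[in LHS]nbwalks_via_mul_adj.
have [|] := boolP (e x w); first by rewrite mul1r [1 + _]addrC addrK.
by rewrite -(nbwalks_via_mul_adj t x w y) => /negbTE->; rewrite !mul0r !mulr0.
Qed.

Lemma sum_adj_nbwalks_mul t x (v : T -> R) :
  \sum_y (\sum_z (e x z)%:R * nbwalks t z y) * v y =
  \sum_z (e x z)%:R * \sum_y nbwalks t z y * v y.
Proof.
under eq_bigr do rewrite mulr_suml.
rewrite exchange_big /=; apply: eq_bigr => z _.
by rewrite mulr_sumr; apply: eq_bigr => y _; rewrite mulrA.
Qed.

(** On an eigenfunction, adjacency acts as the scalar [lambda], so the walk recurrences become those
    of [geronimus]. *)
Lemma nbwalks_geronimus lambda (v : T -> R) :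
  (forall x, \sum_y (e x y)%:R * v y = lambda * v x) ->
  forall t x, \sum_y nbwalks t x y * v y = (geronimus R d t).[lambda] * v x.
Proof.
move=> eigv.
have adj t c : (forall x, \sum_y nbwalks t x y * v y = c * v x) ->
    forall x, \sum_z (e x z)%:R * (\sum_y nbwalks t z y * v y)
              = lambda * c * v x.
  move=> tv x; under eq_bigr do rewrite tv mulrCA.
  by rewrite -mulr_sumr eigv mulrCA mulrA.
have step0 x : \sum_y nbwalks 0 x y * v y = (geronimus R d 0).[lambda] * v x.
  rewrite /= hornerC mul1r (bigD1 x) //= eqxx mul1r big1 ?addr0 // => y yx.
  by rewrite eq_sym (negbTE yx) mul0r.
have step1 x : \sum_y nbwalks 1 x y * v y = (geronimus R d 1).[lambda] * v x.
  under eq_bigr do rewrite nbwalks1.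
  by rewrite sum_adj_nbwalks_mul (adj _ _ step0) /= hornerC hornerX mulr1.
have step2 x : \sum_y nbwalks 2 x y * v y = (geronimus R d 2).[lambda] * v x.
  under eq_bigr do rewrite nbwalks2 mulrBl -mulrA.
  rewrite sumrB sum_adj_nbwalks_mul (adj _ _ step1) -mulr_sumr step0 /=.
  by rewrite hornerD hornerN hornerXn hornerX !hornerC; ring.
have step t : (forall x, \sum_y nbwalks t.+1 x y * v y
                         = (geronimus R d t.+1).[lambda] * v x) /\
              (forall x, \sum_y nbwalks t.+2 x y * v y
                         = (geronimus R d t.+2).[lambda] * v x).
  elim: t => [|t [IH1 IH2]]; first by [].
  split=> // x; under eq_bigr do rewrite nbwalks3 mulrBl -mulrA.
  rewrite sumrB sum_adj_nbwalks_mul (adj _ _ IH2) -mulr_sumr IH1.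
  by rewrite horner_geronimusSSS; ring.
by case=> [//|t]; apply: (step t).1.
Qed.

End NonBacktrackingWalks.

Lemma horner_geronimus_degree (R : comNzRingType) (d t : nat) :
  (geronimus R d t.+1).[d%:R] = d%:R * (d%:R - 1) ^+ t.
Proof.
suff: (geronimus R d t.+1).[d%:R] = d%:R * (d%:R - 1) ^+ t /\
      (geronimus R d t.+2).[d%:R] = d%:R * (d%:R - 1) ^+ t.+1 by case.
elim: t => [|t [IH1 IH2]].
  by rewrite /= hornerD hornerN hornerXn hornerX !hornerC; split; ring.
by split=> //; rewrite horner_geronimusSSS IH1 IH2 !exprS; ring.
Qed.

Lemma sum_geronimus_degree (R : comNzRingType) (d k : nat) : (0 < d)%N ->
  \sum_(0 <= t < k.+1) (geronimus R d t).[d%:R] = (moore_bound d k)%:R.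
Proof.
move=> d_gt0; rewrite big_nat_recl //= hornerC big_mkord /moore_bound.
rewrite natrD natrM natr_sum mulr_sumr; congr (_ + _); apply: eq_bigr => i _.
by rewrite horner_geronimus_degree natrX natrB.
Qed.

Lemma norm_eigenvalue_le_row_sum (R : realDomainType) (T : finType)
    (M : T -> T -> R) (v : T -> R) (lambda r : R) (x0 : T) :
  (forall x y, 0 <= M x y) -> (forall x, \sum_y M x y = r) ->
  v x0 != 0 -> (forall x, \sum_y M x y * v y = lambda * v x) ->
  `|lambda| <= r.
Proof.
move=> M_ge0 Mr vx0 Mv.
have [x _ x_max] := Order.TotalTheory.arg_maxP (fun x => `|v x|) (erefl : xpredT x0).
have vx_gt0 : 0 < `|v x|.
  by apply: Order.POrderTheory.lt_le_trans (x_max x0 isT); rewrite normr_gt0.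
rewrite -(ler_pM2r vx_gt0) -normrM -Mv -(Mr x) mulr_suml.
apply: Order.POrderTheory.le_trans (ler_norm_sum _ _ _) _.
apply: ler_sum => y _; rewrite normrM (ger0_norm (M_ge0 x y)).
by apply: ler_wpM2l => //; apply: x_max.
Qed.

(** [eigenvalue] speaks of row vectors indexed by ordinals; symmetry of [e] turns them into
    eigenfunctions on vertices. *)
Lemma eigenvalue_adjacencyP (R : fieldType) (T : finType) (e : rel T)
    (lambda : R) :
  symmetric e -> eigenvalue (adjacency R e) lambda ->
  exists2 v : T -> R, forall x, \sum_y (e x y)%:R * v y = lambda * v x
                    & exists x, v x != 0.
Proof.
move=> sym_e /eigenvalueP[u uA u_neq0].
exists (fun x => u 0 (enum_rank x)) => [x|].
  move/rowP/(_ (enum_rank x)): uA; rewrite !mxE => <-.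
  rewrite (reindex (@enum_val T T)) /=; last first.
    by exists enum_rank => i _; [apply: enum_valK | apply: enum_rankK].
  by apply: eq_bigr => i _; rewrite mxE enum_valK enum_rankK sym_e mulrC.
have /rV0Pn[i ui] := u_neq0.
by exists (enum_val i); rewrite enum_valK.
Qed.

(** Summing the eigenvalue equation over all vertices gives [lambda] times the total on one side
    and, by regularity, [d] times it on the other. *)
Lemma sum_eigenfunction_eq0 (R : realDomainType) (T : finType) (e : rel T)
    (d : nat) (lambda : R) (v : T -> R) :
  symmetric e -> (forall x, #|[set y | e x y]| = d) ->
  (forall x, \sum_y (e x y)%:R * v y = lambda * v x) -> lambda != d%:R ->
  \sum_x v x = 0.
Proof.
move=> sym_e reg_e eigv neq.
have : (lambda - d%:R) * (\sum_x v x) = 0.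
  rewrite mulrBl mulr_sumr; under eq_bigr do rewrite -eigv.
  rewrite exchange_big /= mulr_sumr -sumrB big1 // => y _.
  rewrite -mulr_suml; under eq_bigr do rewrite sym_e.
  by rewrite (sum_adj R reg_e) subrr.
by move/eqP; rewrite mulf_eq0 subr_eq0 (negbTE neq) => /eqP.
Qed.

Theorem theorem3p1 (R : rcfType) (T : finType) (e : rel T) (d k : nat)
    (hG : dk_graph e d k) (lambda : R)
    (hlambda : nontrivial_eigenvalue e d lambda) :
  `|\sum_(0 <= t < k.+1) (geronimus R d t).[lambda]|
    <= (moore_bound d k)%:R - #|T|%:R.
Proof.
case: hG => d_gt0 _ sym_e _ reg_e [diam _].
case/andP: hlambda => /(eigenvalue_adjacencyP sym_e)[v eigv [x0 vx0]] neq.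
pose S x y : R := \sum_(0 <= t < k.+1) nbwalks R e t x y.
have S_eigen mu w : (forall x, \sum_y (e x y)%:R * w y = mu * w x) ->
    forall x, \sum_y S x y * w y
              = (\sum_(0 <= t < k.+1) (geronimus R d t).[mu]) * w x.
  move=> eigw x; under eq_bigr do rewrite mulr_suml.
  rewrite exchange_big /= mulr_suml; apply: eq_bigr => t _.
  exact: nbwalks_geronimus.
apply: (norm_eigenvalue_le_row_sum (M := fun x y => S x y - 1) (v := v)) vx0 _
  => [x y|x|x].
(* The term at [t = m], the distance from [x] to [y], is already at least 1. *)
- have [m /(nbwalks_is_dist R) m_ge1 m_le] := diam x y.
  rewrite subr_ge0 /S big_mkord (bigD1 (inord m)) //= inordK //.
  rewrite -[1]addr0 lerD //.
  by apply: sumr_ge0 => t _; apply: nbwalks_ge0.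
(* The row sums of [S] come from [S_eigen] for the constant function 1, whose eigenvalue is [d]. *)
- rewrite sumrB sumr_const -(sum_geronimus_degree R k d_gt0).
  congr (_ - _); rewrite -[RHS]mulr1.
  rewrite -(S_eigen d%:R (fun=> 1) _ x) => [|z].
    by apply: eq_bigr => y _; rewrite mulr1.
  by under eq_bigr do rewrite mulr1; rewrite (sum_adj R reg_e) mulr1.
- under eq_bigr do rewrite mulrBl mul1r.
  rewrite sumrB (sum_eigenfunction_eq0 sym_e reg_e eigv neq) subr0.
  exact: S_eigen.
Qed.
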